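(* (1) For all positive integers $k,n$ and every $(\sqcap,\sqcup)$-closed set $M\subseteq{S_k}^n$, the PIP $(M^{\mathrm{ir}},\preceq,\smile)$ is elementary. (2) For every elementary PIP $P$, there is a $(\sqcap,\sqcup)$-closed set $M$ (in ${S_k}^n$ for some positive integers $k,n$) such that $(M,\preceq)$ is isomorphic, as a poset, to $(\mathcal{C}(P),\subseteq)$.
   Context: All posets are finite. $S_k$ and closed sets. For a positive integer $k$ let $S_k=\{0,1,\dots,k\}$, partially ordered by: $a\preceq b$ iff $a\in\{0,b\}$. ${S_k}^n$ has the componentwise order, also denoted $\preceq$. For $x,y\in{S_k}^n$ define $x\sqcap y$, $x\sqcup y$ componentwise: if $x_i,y_i$ are comparable, $(x\sqcap y)_i=\min\{x_i,y_i\}$ and $(x\sqcup y)_i=\max\{x_i,y_i\}$ (with respect to $\preceq$); otherwise both are $0$. A nonempty subset $M\subseteq {S_k}^n$ is $(\sqcap,\sqcup)$-closed if it is closed under both operations. $M^{\mathrm{ir}}$ is the set of join-irreducible elements of $M$: elements that are not the minimum of $M$ and are not a join (in $M$) of other elements of $M$. For $x,y\in{S_k}^n$, $x\smile y$ means that the join $x\vee y$ does not exist in ${S_k}^n$. PIPs. A poset with inconsistent pairs (PIP) is a poset $(P,\le)$ with a symmetric relation $\smile$ such that (IC1) if $p\smile q$ there is no $r\in P$ with $p\le r$ and $q\le r$; (IC2) if $p'\le p$, $q'\le q$ and $p'\smile q'$, then $p\smile q$. A pair $\{p,q\}$ is inconsistent if $p\smile q$. An inconsistent pair $\{p,q\}$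 is minimally inconsistent if for all $p',q'\in P$, $p'\le p$, $q'\le q$ and $p'\smile q'$ imply $p'=p$ and $q'=q$. An ideal (down-closed subset, possibly empty) of $P$ is consistent if it contains no inconsistent pair; $\mathcal{C}(P)$ is the family of consistent ideals, ordered by inclusion. For a $(\sqcap,\sqcup)$-closed set $M$, the triple $(M^{\mathrm{ir}},\preceq,\smile)$ is a PIP. Elementary PIPs. A PIP $P$ is elementary if: (EP0) $P$ is the disjoint union of (possibly empty) sets $P_1,\dots,P_n$ such that every pair $\{x,y\}\subseteq P$ of distinct elements is minimally inconsistent if and only if $\{x,y\}\subseteq P_i$ for some $i$; (EP1) for any distinct $i,j$, if $|P_i|\ge2$ and $P_j=\{y\}$, there is no $x\in P_i$ with $x<y$; (EP2) for any distinct $i,j$ with $|P_i|\ge 2$ and $|P_j|\ge2$, either (EP2-1) every pair of $x\in P_i$ and $y\in P_j$ is not comparable, or (EP2-2) there exist $x^\circ\in P_i$ and $y^\circ\in P_j$ such that $x^\circ<y$ and $y^\circ<x$ for all $x\in P_i\setminus\{x^\circ\}$ and $y\in P_j\setminus\{y^\circ\}$. *)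

(* Defs.v *)
From HB Require Import structures.
From mathcomp Require Import all_boot all_order.

Set Implicit Arguments.
Unset Strict Implicit.
Unset Printing Implicit Defensive.

Import Order.Theory.
Local Open Scope order_scope.

(* [Sk k] is an alias of ['I_k.+1] that hides the usual total order on ['I_k.+1]. *)
Definition Sk (k : nat) : Type := 'I_k.+1.

HB.instance Definition _ k := Finite.on (Sk k).

Section SkOrder.
Variable k : nat.
Implicit Types a b c : Sk k.

Definition Sk_le : rel (Sk k) := fun a b => (a == ord0) || (a == b).

Fact Sk_le_refl : reflexive Sk_le.
Proof. by move=> a; rewrite /Sk_le eqxx orbT. Qed.

Fact Sk_le_anti : antisymmetric Sk_le.
Proof.
move=> a b /andP[/orP[/eqP-> | /eqP-> //]].
by case/orP=> /eqP->.
Qed.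

Fact Sk_le_trans : transitive Sk_le.
Proof.
move=> b a c /orP[/eqP-> _ | /eqP-> //].
by rewrite /Sk_le eqxx.
Qed.

End SkOrder.

Fact Sk_display : Order.disp_t. Proof. exact: (Order.Disp tt tt). Qed.

HB.instance Definition _ k :=
  Order.Le_isPOrder.Build Sk_display (Sk k)
    (@Sk_le_refl k) (@Sk_le_anti k) (@Sk_le_trans k).

(* [n.-tupleprod] carries the componentwise order. *)
Notation Skn k n := (n.-tupleprod (Sk k))%type.

Section Operations.
Variables k n : nat.
Implicit Types (x y : Skn k n) (M : {set Skn k n}).

Definition Sk_sqcap (a b : Sk k) : Sk k :=
  if a >=< b then Order.min a b else ord0.

Definition Sk_sqcup (a b : Sk k) : Sk k :=
  if a >=< b then Order.max a b else ord0.

Definition sqcap x y : Skn k n := [tuple Sk_sqcap (tnth x i) (tnth y i) | i < n].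
Definition sqcup x y : Skn k n := [tuple Sk_sqcup (tnth x i) (tnth y i) | i < n].

Definition sq_closed M : Prop :=
  M != set0 /\
  forall x y, x \in M -> y \in M -> sqcap x y \in M /\ sqcup x y \in M.

End Operations.

Section Joins.
Variables (d : Order.disp_t) (T : finPOrderType d).
Implicit Types (M A : {set T}) (x y z : T).

(* The least upper bound is relative to the subposet [M]; [A] is meant to be
   a subset of [M]. *)
Definition is_join M A z : bool :=
  [&& z \in M, [forall a in A, a <= z] &
      [forall u in M, [forall a in A, a <= u] ==> (z <= u)]].

Definition is_minimum M x : bool := (x \in M) && [forall y in M, x <= y].

(* [A] may be empty: its join is then the minimum of [M], which is excluded anyway. *)
Definition join_irreducibles M : {set T} :=
  [set x in M | ~~ is_minimum M x &
     ~~ [exists A : {set T}, (A \subset M :\ x) && is_join M A x]].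

Definition no_join x y : bool := ~~ [exists z, is_join setT [set x; y] z].

End Joins.

Section IrreduciblePoset.
Variables (d : Order.disp_t) (T : finPOrderType d) (M : {set T}).

Definition irr_poset : Type := {x : T | x \in join_irreducibles M}.

HB.instance Definition _ := SubFinite.on irr_poset.
HB.instance Definition _ := [SubChoice_isSubPOrder of irr_poset by <: with d].

(* The join is taken in [T], not in [M]: for [T := Skn k n] this is the
   relation $\smile$ on ${S_k}^n$ restricted to $M^{\mathrm{ir}}$. *)
Definition irr_incons : rel irr_poset := fun p q => no_join (val p) (val q).

End IrreduciblePoset.

Section PIP.
Variables (d : Order.disp_t) (P : finPOrderType d) (inc : rel P).
Implicit Types (p q r x y : P) (I : {set P}).

Definition is_pip : Prop :=
  [/\ symmetric inc,
      forall p q, inc p q -> ~ exists r, p <= r /\ q <= r &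
      forall p q p' q', p' <= p -> q' <= q -> inc p' q' -> inc p q].

Definition min_incons p q : Prop :=
  inc p q /\
  forall p' q', p' <= p -> q' <= q -> inc p' q' -> p' = p /\ q' = q.

Definition is_ideal I : bool :=
  [forall p in I, forall q, (q <= p) ==> (q \in I)].

Definition is_consistent I : bool :=
  [forall p in I, forall q in I, ~~ inc p q].

Definition consistent_ideals : {set {set P}} :=
  [set I | is_ideal I & is_consistent I].

Section Parts.
Variables (m : nat) (B : 'I_m -> {set P}).

Definition EP0 : Prop :=
  [/\ forall x, exists i, x \in B i,
      forall i j, i != j -> [disjoint B i & B j] &
      forall x y, x != y ->
        (min_incons x y <-> exists i, x \in B i /\ y \in B i)].

Definition EP1 : Prop :=
  forall i j y, i != j -> (2 <= #|B i|)%N -> B j = [set y] ->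
    ~ exists2 x, x \in B i & x < y.

Definition EP2 : Prop :=
  forall i j, i != j -> (2 <= #|B i|)%N -> (2 <= #|B j|)%N ->
    (forall x y, x \in B i -> y \in B j -> x >< y) \/
    (exists x0 y0, [/\ x0 \in B i, y0 \in B j &
       forall x y, x \in B i :\ x0 -> y \in B j :\ y0 -> x0 < y /\ y0 < x]).

End Parts.

Definition elementary : Prop :=
  is_pip /\ exists (m : nat) (B : 'I_m -> {set P}), [/\ EP0 B, EP1 B & EP2 B].

End PIP.

Definition order_isomorphic (T U : finType) (A : {set T}) (leT : rel T)
    (B : {set U}) (leU : rel U) : Prop :=
  exists f : T -> U,
    [/\ {in A &, injective f}, f @: A = B &
        {in A &, forall x y, leU (f x) (f y) = leT x y}].

(* Main.v *)
Require Import Defs.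
From mathcomp Require Import all_boot all_order.

Set Implicit Arguments.
Unset Strict Implicit.
Unset Printing Implicit Defensive.

Import Order.Theory.

(** The first half rests on one operation. In a closed set [M], the element
    [override x y], built from two applications of [sqcup], takes the coordinate
    of [x] wherever it is nonzero and that of [y] elsewhere. The irreducibles of
    [M] are elements that are least in [M] among those sharing one of their
    nonzero coordinates; call the index of such a coordinate an origin. If [x] in
    [M] clashes with an irreducible [q] anywhere (different nonzero values), then
    it clashes with [q] at every origin [j] of [q] ([clash_at_origin]): otherwise
    [override x q] would agree with [q] at [j], hence lie above [q], while
    keeping the coordinates of [x] at the clash.

    It follows that two distinct irreducibles are minimally inconsistent exactly
    when they share an origin ([min_inconsP]), and that they then share all their
    origins, so that sharing an origin is an equivalence relation, whose classes
    are the parts required by (EP0). If [p < q] and [r] is another member of the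
    class of [p], then [r] is inconsistent with [q] and clashes with it at the
    origins of [q]; below [r] there is thus an irreducible in the class of [q]
    other than [q] ([sibling_below]). This gives (EP1) at once, and (EP2) by
    applying it back and forth between two classes ([sibling_cross]).

    For the second half, number the points of [P] and send a consistent ideal
    [I] to the vector whose coordinate [i] is the number of the only point of [I]
    in the part [P_i], or [0] if there is none. This map is an order embedding,
    and [sqcap] corresponds to intersection. The operation [sqcup] corresponds to
    [merge I J], the union without the points that share their part with another
    point of the union. All the content is that [merge I J] is still an ideal
    ([merge_down]), and this is what (EP1) and (EP2) are for; it is consistent
    because every inconsistent pair lies above a minimal one, and minimal ones
    lie in a single part. *)

(** * Finite posets and minimal inconsistent pairs *)

Section Extrema.
Local Open Scope order_scope.

Lemma exists_minimal d (T : finPOrderType d) (A : {set T}) x : x \in A ->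
  exists p, [/\ p \in A, p <= x & forall y, y \in A -> y <= p -> y = p].
Proof.
pose down (p : T) := #|[set y | y <= p]|.
move=> xA; have xP : (x \in A) && (x <= x) by rewrite xA lexx.
case: (@arg_minnP _ x [pred z in A | z <= x] down xP) => p /andP[pA p_x] min_p.
exists p; split=> // y yA y_p; apply/eqP/contraT => y_neq_p.
have: (down p <= down y)%N by apply: min_p; rewrite /= yA (le_trans y_p).
rewrite leqNgt => /negP[]; apply: proper_card.
apply/properP; split; first by apply/subsetP => z; rewrite !inE => /le_trans->.
by exists p; rewrite !inE ?lexx // lt_geF // lt_neqAle y_neq_p.
Qed.

Lemma exists_maximal d (T : finPOrderType d) (A : {set T}) x : x \in A ->
  exists p, [/\ p \in A, x <= p & forall y, y \in A -> p <= y -> y = p].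
Proof. exact: (@exists_minimal _ T^d A x). Qed.

End Extrema.

Section MinimalPairs.
Variables (d : Order.disp_t) (T : finPOrderType d).
Implicit Types (A : {set T}) (x y : T).
Local Open Scope order_scope.

Lemma exists_other A x : x \in A -> (2 <= #|A|)%N -> exists2 y, y \in A & y != x.
Proof.
move=> xA; rewrite (cardsD1 x) xA ltnS => /card_gt0P[y].
by rewrite !inE => /andP[y_x yA]; exists y.
Qed.

Variable inc : rel T.
Hypothesis pip : is_pip inc.

Lemma inc_no_bound p q r : p <= r -> q <= r -> inc p q = false.
Proof.
by case: pip => _ ic1 _ pr qr; apply/negP => /ic1; apply; exists r.
Qed.

(** Shrinking first one member of the pair and then the other already reaches
    a minimal pair, because inconsistency is inherited upwards. *)
Lemma min_incons_below p q : inc p q ->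
  exists p' q', [/\ p' <= p, q' <= q & min_incons inc p' q'].
Proof.
case: pip => _ _ up inc_pq.
have [|p' [p'P p'_p min_p']] := @exists_minimal _ _ [set x | inc x q] p.
  by rewrite inE.
have [|q' [q'P q'_q min_q']] := @exists_minimal _ _ [set x | inc p' x] q.
  by rewrite inE in p'P; rewrite inE.
rewrite !inE in p'P q'P; exists p', q'; split=> //; split=> // p1 q1 p1_p' q1_q' inc1.
have def_p1 : p1 = p'.
  apply: min_p' => //; rewrite inE.
  by apply: up inc1; [exact: lexx | exact: le_trans q'_q].
by split=> //; apply: min_q' => //; rewrite inE -def_p1.
Qed.

End MinimalPairs.

(** * Coordinatewise comparison *)

Section Coordinates.
Variables k n : nat.
Implicit Types (a b : Sk k) (x y z : Skn k n).
Local Open Scope order_scope.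

Lemma Sk_leE a b : (a <= b) = (a == ord0) || (a == b).
Proof. by []. Qed.

Lemma Sk_le0 b : (ord0 : Sk k) <= b.
Proof. by rewrite Sk_leE eqxx. Qed.

Lemma Sk_incomparableE a b : (a >< b) = [&& a != ord0, b != ord0 & a != b].
Proof.
rewrite /Order.comparable !Sk_leE !negb_or (eq_sym b a).
by do !case: (_ == _).
Qed.

Lemma Sk_sqcapE a b : Sk_sqcap a b = if a == b then a else ord0.
Proof.
rewrite /Sk_sqcap /Order.min lt_neqAle -[a >=< b]negbK Sk_incomparableE Sk_leE.
have [->|_] := eqVneq a b; first by rewrite !andbF.
have [->|_] := eqVneq a ord0; first by case: eqP.
by case: eqP.
Qed.

Lemma Sk_sqcupE a b : Sk_sqcup a b =
  if a == ord0 then b else if b == ord0 then a else if a == b then a else ord0.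
Proof.
rewrite /Sk_sqcup /Order.max lt_neqAle -[a >=< b]negbK Sk_incomparableE Sk_leE.
case: (eqVneq a ord0) => [->|na] /=; last first.
  by case: (eqVneq b ord0) => [->|nb] /=; case: eqVneq.
by rewrite andbT; case: eqP.
Qed.

Lemma tnth_sqcap x y i : tnth (sqcap x y) i = Sk_sqcap (tnth x i) (tnth y i).
Proof. by rewrite tnth_mktuple. Qed.

Lemma tnth_sqcup x y i : tnth (sqcup x y) i = Sk_sqcup (tnth x i) (tnth y i).
Proof. by rewrite tnth_mktuple. Qed.

Lemma Skn_leP x y : reflect (forall i, tnth x i <= tnth y i) (x <= y).
Proof. by rewrite leEtprod; apply: forallP. Qed.

Lemma le_coord x y i : x <= y -> tnth x i != ord0 -> tnth x i = tnth y i.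
Proof. by move/Skn_leP/(_ i); rewrite Sk_leE => /orP[->|/eqP]. Qed.

Lemma sqcap_lel x y : sqcap x y <= x.
Proof.
apply/Skn_leP => i; rewrite tnth_sqcap Sk_sqcapE.
by case: eqP => _; rewrite ?lexx ?Sk_le0.
Qed.

Lemma sqcap_ler x y : sqcap x y <= y.
Proof.
apply/Skn_leP => i; rewrite tnth_sqcap Sk_sqcapE.
by case: eqP => [->|_]; rewrite ?lexx ?Sk_le0.
Qed.

Lemma bounded_comparable x y z i : x <= z -> y <= z -> tnth x i >=< tnth y i.
Proof.
move=> xz yz; rewrite -[_ >=< _]negbK Sk_incomparableE; apply/negP.
case/and3P=> nx ny; rewrite (le_coord xz nx) (le_coord yz ny) eqxx //.
Qed.

Lemma sqcup_ub x y : (forall i, tnth x i >=< tnth y i) ->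
  x <= sqcup x y /\ y <= sqcup x y.
Proof.
move=> compat; split; apply/Skn_leP => i; rewrite tnth_sqcup /Sk_sqcup compat;
  by case: (comparable_leP (compat i)) => // /ltW.
Qed.

Lemma sqcup_le x y z : x <= z -> y <= z -> sqcup x y <= z.
Proof.
move=> /Skn_leP xz /Skn_leP yz; apply/Skn_leP => i.
rewrite tnth_sqcup Sk_sqcupE.
by do !case: ifP => _ //; exact: Sk_le0.
Qed.

Lemma no_joinE x y : no_join x y = [exists i, tnth x i >< tnth y i].
Proof.
apply/idP/idP => [|/existsP[i clash]].
  apply: contraR => /existsPn compat; apply/existsP; exists (sqcup x y).
  have [x_xy y_xy] := sqcup_ub (fun i => negbNE (compat i)).
  rewrite /is_join inE /=; apply/andP; split.
    by apply/forall_inP => a; rewrite !inE => /orP[]/eqP->.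
  apply/forall_inP => u _; apply/implyP => /forall_inP ub.
  by apply: sqcup_le; apply: ub; rewrite !inE eqxx ?orbT.
apply/existsPn => z; apply/negP => /and3P[_ /forall_inP ub _].
have xz : x <= z by apply: ub; rewrite !inE eqxx.
have yz : y <= z by apply: ub; rewrite !inE eqxx orbT.
by rewrite (bounded_comparable i xz yz) in clash.
Qed.

End Coordinates.

(** * The irreducibles of a closed set form an elementary PIP *)

Section ClosedSet.
Variables (k n : nat) (M : {set Skn k n}).
Hypothesis clM : sq_closed M.
Implicit Types (x y z : Skn k n) (i j : 'I_n) (p q r s u v : irr_poset M).
Local Open Scope order_scope.

Lemma sqcap_in x y : x \in M -> y \in M -> sqcap x y \in M.
Proof. by case: clM => _ /[apply] /[apply] -[]. Qed.

Lemma sqcup_in x y : x \in M -> y \in M -> sqcup x y \in M.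
Proof. by case: clM => _ /[apply] /[apply] -[]. Qed.

(** Applying [sqcup] with [x] a second time restores the coordinates of [x] that
    the first application cancelled. *)
Definition override x y := sqcup (sqcup x y) x.

Lemma tnth_override x y i :
  tnth (override x y) i = if tnth x i == ord0 then tnth y i else tnth x i.
Proof.
rewrite !tnth_sqcup !Sk_sqcupE.
have [->|nx] := eqVneq (tnth x i) ord0.
  by case: ifP => // /eqP->.
have [ny|ny] := eqVneq (tnth y i) ord0; first by rewrite (negPf nx) ?eqxx.
have [exy|_] := eqVneq (tnth x i) (tnth y i); last by rewrite ?eqxx.
by rewrite (negPf nx) ?eqxx.
Qed.

Lemma override_in x y : x \in M -> y \in M -> override x y \in M.
Proof. by move=> xM yM; rewrite !sqcup_in. Qed.

(** The index [i] is an origin of [x]. *)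
Definition least_at i x :=
  [&& x \in M, tnth x i != ord0 &
      [forall y in M, (tnth y i == tnth x i) ==> (x <= y)]].

Lemma least_at_in i x : least_at i x -> x \in M.
Proof. by case/and3P. Qed.

Lemma least_at_neq0 i x : least_at i x -> tnth x i != ord0.
Proof. by case/and3P. Qed.

Lemma least_at_le i x y :
  least_at i x -> y \in M -> tnth y i = tnth x i -> x <= y.
Proof.
by case/and3P=> _ _ /forall_inP least yM /eqP; apply/implyP/least.
Qed.

(** Closure under [sqcap], which keeps a common coordinate, makes a minimal
    element with a given coordinate least. *)
Lemma exists_least_at i x : x \in M -> tnth x i != ord0 ->
  exists y, [/\ least_at i y, y <= x & tnth y i = tnth x i].
Proof.
move=> xM nx; pose A := [set y in M | tnth y i == tnth x i].
have [|y [yA yx min_y]] := @exists_minimal _ _ A x; first by rewrite inE xM /=.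
move: yA; rewrite inE => /andP[yM /eqP y_x].
exists y; split=> //; rewrite /least_at yM y_x nx /=.
apply/forall_inP => z zM; apply/implyP => /eqP z_x.
rewrite -(min_y (sqcap y z)) ?sqcap_ler ?sqcap_lel //.
by rewrite inE sqcap_in // tnth_sqcap Sk_sqcapE y_x z_x eqxx /=.
Qed.

Lemma irr_in p : val p \in M.
Proof. by have:= valP p; rewrite inE => /andP[]. Qed.

(** If [p] had no origin, every nonzero coordinate of [p] would already occur in
    an element of [M] strictly below [p], and [p] would be the join of these. *)
Lemma irr_least_at p : exists i, least_at i (val p).
Proof.
apply/existsP; have:= valP p; rewrite inE => /and3P[pM _].
apply: contraR => /existsPn not_least; apply/existsP.
exists [set x in M | x < val p]; apply/andP; split.
  by apply/subsetP => x; rewrite !inE lt_neqAle => /and3P[-> ->].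
apply/and3P; split=> //.
  by apply/forall_inP => x; rewrite inE => /andP[_ /ltW].
apply/forall_inP => u uM; apply/implyP => /forall_inP ub.
apply/Skn_leP => i; have [->|ni] := eqVneq (tnth (val p) i) ord0; first exact: Sk_le0.
have [y [ly yp y_i]] := exists_least_at pM ni.
rewrite -y_i; apply/Skn_leP/ub; rewrite inE (least_at_in ly) lt_neqAle yp andbT.
by apply: contraTneq ly => ->.
Qed.

(** All elements of [M] strictly below [x] vanish at [i]; being pairwise
    compatible, they have joins in [M], which also vanish at [i], so they never
    join to [x]. The clashing [y] serves to show that [x] is not the minimum of
    [M], whose nonzero coordinates are shared by all of [M]. *)
Lemma least_at_irr i x y : y \in M -> tnth x i >< tnth y i -> least_at i x ->
  x \in join_irreducibles M.
Proof.
move=> yM clash lx; have xM := least_at_in lx; have nx := least_at_neq0 lx.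
have not_le z : z \in M -> tnth z i != tnth x i -> ~~ (x <= z).
  move=> zM; apply: contra => xz; rewrite (le_coord xz nx) //.
have y_x : tnth y i != tnth x i.
  by move: clash; rewrite Sk_incomparableE => /and3P[_ _]; rewrite eq_sym.
rewrite inE xM /=; apply/andP; split.
  apply/negP => /andP[_ /forall_inP/(_ y yM)].
  by rewrite (negPf (not_le y yM y_x)).
pose A := [set z in M | z < x].
have vanish z : z \in M -> z < x -> tnth z i = ord0.
  move=> zM z_x; apply/eqP/contraT => nz; have zx := ltW z_x.
  by rewrite -(lt_geF z_x) (least_at_le lx) // (le_coord zx nz).
have cap_lt : sqcap x y < x.
  rewrite lt_neqAle sqcap_lel andbT; apply: contraTneq nx => def_x.
  by rewrite -{1}def_x tnth_sqcap Sk_sqcapE [_ == tnth y i]eq_sym (negPf y_x).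
have [|m [mA _ max_m]] := @exists_maximal _ _ A (sqcap x y).
  by rewrite inE sqcap_in.
move: mA; rewrite inE => /andP[mM m_x].
have ub z : z \in M -> z < x -> z <= m.
  move=> zM z_x; have comp j := bounded_comparable j (ltW m_x) (ltW z_x).
  have [m_mz z_mz] := sqcup_ub comp; rewrite -(max_m (sqcup m z)) //.
  rewrite inE sqcup_in // lt_neqAle sqcup_le ?ltW // andbT.
  apply: contraNneq nx => <-; rewrite tnth_sqcup Sk_sqcupE.
  by rewrite (vanish m) // (vanish z) // eqxx.
apply/existsPn => B; apply/negP => /andP[/subsetP subB /and3P[_ /forall_inP ubB]].
move/forall_inP/(_ m mM)/implyP => lub; suff: x <= m by rewrite (lt_geF m_x).
apply: lub; apply/forall_inP => z zB; have:= subB z zB.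
by rewrite !inE => /andP[z_x zM]; apply: ub => //; rewrite lt_neqAle z_x ubB.
Qed.

(** Combines the two preceding existence results: the clash makes the least
    element with the coordinate of [x] at [i] irreducible. *)
Lemma irr_at i x y : x \in M -> y \in M -> tnth x i >< tnth y i ->
  exists p, [/\ least_at i (val p), val p <= x & tnth (val p) i = tnth x i].
Proof.
move=> xM yM clash; have nx : tnth x i != ord0.
  by move: clash; rewrite Sk_incomparableE => /and3P[].
have [z [lz zx z_x]] := exists_least_at xM nx.
have zir : z \in join_irreducibles M by apply: (least_at_irr yM _ lz); rewrite z_x.
by exists (exist _ z zir).
Qed.

(** If [x] does not clash with [q] at [j], then [override x q] still has the
    coordinate of [q] at [j], hence lies above [q]; but wherever [x] clashes
    with [q] it has the coordinate of [x]. *)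
Lemma clash_at_origin x q i j : x \in M -> least_at j (val q) ->
  tnth x i >< tnth (val q) i -> tnth x j >< tnth (val q) j.
Proof.
move=> xM lq; apply: contraLR; rewrite negbK => comp_j; rewrite negbK.
have nqj := least_at_neq0 lq.
have: val q <= override x (val q).
  apply: (least_at_le lq); first exact: override_in (irr_in q).
  rewrite tnth_override; case: eqVneq => // nxj.
  move: comp_j; rewrite -[_ >=< _]negbK Sk_incomparableE nxj nqj /= negbK.
  by move/eqP.
move/Skn_leP/(_ i); rewrite tnth_override.
case: eqVneq => [->|_]; last by rewrite comparable_sym => /le_comparable.
by move=> _; apply: le_comparable; apply: Sk_le0.
Qed.

Notation inc := (@irr_incons _ _ M).

Lemma irr_inconsE p q : inc p q = [exists i, tnth (val p) i >< tnth (val q) i].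
Proof. exact: no_joinE. Qed.

Lemma irr_pip : is_pip inc.
Proof.
split=> [p q|p q|p q p' q'].
- by rewrite !irr_inconsE; apply: eq_existsb => i; rewrite comparable_sym.
- rewrite irr_inconsE => /existsP[i clash] [r [pr qr]].
  by rewrite (@bounded_comparable _ _ _ _ (val r) i) in clash.
rewrite !irr_inconsE => p'p q'q /existsP[i]; rewrite Sk_incomparableE.
case/and3P=> np nq; rewrite (le_coord p'p np) (le_coord q'q nq) => neq.
apply/existsP; exists i; rewrite Sk_incomparableE neq.
by rewrite -(le_coord p'p np) -(le_coord q'q nq) np nq.
Qed.

Lemma inc_clash p q j : inc p q -> least_at j (val q) ->
  tnth (val p) j >< tnth (val q) j.
Proof.
by rewrite irr_inconsE => /existsP[i clash] lq; apply: clash_at_origin clash; rewrite ?irr_in.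
Qed.

(** For distinct [p] and [q] this turns out to be minimal inconsistency; in this
    form reflexivity and symmetry are immediate. *)
Definition sibling p q := [exists i, least_at i (val p) && least_at i (val q)].

Lemma sibling_refl : reflexive sibling.
Proof. by move=> p; have [i lp] := irr_least_at p; apply/existsP; exists i; rewrite lp. Qed.

Lemma sibling_sym : symmetric sibling.
Proof. by move=> p q; apply: eq_existsb => i; rewrite andbC. Qed.

Lemma least_at_inj i p q : least_at i (val p) -> least_at i (val q) ->
  tnth (val p) i = tnth (val q) i -> p = q.
Proof.
move=> lp lq e; apply/val_inj/le_anti.
by rewrite !(least_at_le (i := i)) ?irr_in.
Qed.

Lemma sibling_le_eq p q : sibling p q -> p <= q -> p = q.
Proof.
case/existsP=> i /andP[lp lq] pq; apply: (least_at_inj lp lq).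
exact: le_coord pq (least_at_neq0 lp).
Qed.

Lemma sibling_inc p q : p != q -> sibling p q -> inc p q.
Proof.
move=> neq /existsP[i /andP[lp lq]]; rewrite irr_inconsE; apply/existsP; exists i.
rewrite Sk_incomparableE !least_at_neq0 //=.
by apply: contra neq => /eqP/(least_at_inj lp lq)->.
Qed.

(** The irreducible below [p] that carries the coordinate of [p] at the origin
    [j] of [q] is already inconsistent with [q], so by minimality it is [p]. *)
Lemma min_incons_shift p q j : min_incons inc p q -> least_at j (val q) -> least_at j (val p).
Proof.
case=> inc_pq min lq; have clash := inc_clash inc_pq lq.
have [r [lr rp r_p]] := irr_at (irr_in p) (irr_in q) clash.
have [<- //] : r = p /\ q = q.
by apply: min => //; rewrite irr_inconsE; apply/existsP; exists j; rewrite r_p.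
Qed.

(** If [p] and [q] have the common origin [i] and [p' <= p] is inconsistent with
    [q], then [p'] and [q] clash at [i], so [p'] has the coordinate of [p] at [i]
    and [p <= p']. The other direction is [min_incons_shift]. *)
Lemma min_inconsP p q : p != q -> min_incons inc p q <-> sibling p q.
Proof.
move=> neq; split=> [min|sib].
  have [j lq] := irr_least_at q.
  by apply/existsP; exists j; rewrite (min_incons_shift min lq).
split=> [|p' q' p'p q'q inc']; first exact: sibling_inc.
have [sym _ up] := irr_pip.
have shrink r s r' s' : sibling r s -> r' <= r -> s' <= s -> inc r' s' -> r' = r.
  case/existsP=> i /andP[lr ls] r'r s's inc_rs'.
  have: inc r' s by apply: up inc_rs'.
  move/inc_clash => /(_ i ls); rewrite Sk_incomparableE => /and3P[nr' _ _].
  apply/val_inj/le_anti/andP; split=> //; apply: least_at_le lr (irr_in _) _.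
  exact: le_coord r'r nr'.
split; first exact: shrink sib p'p q'q inc'.
by apply: shrink q'q p'p _; [rewrite sibling_sym | rewrite sym].
Qed.

Lemma sibling_shift p q j : sibling p q -> least_at j (val q) -> least_at j (val p).
Proof.
have [<- //|neq] := eqVneq p q; move=> /(min_inconsP neq); exact: min_incons_shift.
Qed.

Lemma sibling_trans : transitive sibling.
Proof.
move=> q p r sib_pq /existsP[j /andP[lq lr]].
by apply/existsP; exists j; rewrite lr (sibling_shift sib_pq lq).
Qed.

(** Since [r] is inconsistent with [p], it is inconsistent with [q], hence clashes
    with [q] at [j]; [u] is the irreducible below [r] carrying that coordinate. *)
Lemma sibling_below p q r j : p <= q -> sibling p r -> r != p -> least_at j (val q) ->
  exists u, [/\ least_at j (val u), u <= r & u != q].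
Proof.
move=> pq sib neq lq.
have inc_rq : inc r q.
  have [sym _ up] := irr_pip.
  by apply: (up r q r p) => //; apply: sibling_inc; rewrite // sibling_sym.
have clash := inc_clash inc_rq lq.
have [u [lu ur u_r]] := irr_at (irr_in r) (irr_in q) clash.
exists u; split=> //; apply: contraTneq clash => <-.
by rewrite u_r comparablexx.
Qed.

(** Every [r != p] in the class of [p] lies above some sibling [u] of [q], by
    [sibling_below] applied to [p < q]. Applied to [u < r], the same lemma puts
    under each sibling [v != u] of [q] a sibling [s != r] of [p]. This shows that
    [u] does not depend on [r]: for another [u'] below some [r'], taking [v := u']
    squeezes [u'] between the siblings [s] and [r'] of [p]. It also shows [s = p],
    for otherwise [u <= s <= v] with [u] and [v] siblings. *)
Lemma sibling_cross p q r0 : p < q -> ~~ sibling p q -> sibling p r0 -> r0 != p ->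
  exists u, sibling q u /\
   forall r v, sibling p r -> r != p -> sibling q v -> v != u -> p < v /\ u < r.
Proof.
move=> pq nsib sib0 neq0.
have [i lp] := irr_least_at p; have [j lq] := irr_least_at q.
have lpi r : sibling p r -> least_at i (val r).
  by rewrite sibling_sym => /sibling_shift; apply.
have across r v : sibling p r -> sibling q v -> v != r.
  move=> sr sv; apply: contra nsib => /eqP v_r.
  by apply: sibling_trans sr _; rewrite sibling_sym -v_r.
have sibI v : least_at j (val v) -> sibling q v.
  by move=> lv; apply/existsP; exists j; rewrite lq.
have below r : sibling p r -> r != p -> exists2 u, sibling q u & u <= r.
  move=> sr nr; have [u [lu ur _]] := sibling_below (ltW pq) sr nr lq.
  by exists u => //; apply: sibI.
have above u v r : sibling q u -> sibling q v -> sibling p r -> u <= r -> v != u ->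
    exists s, [/\ sibling p s, s <= v & s != r].
  move=> su sv sr ur nvu; have suv : sibling u v.
    by apply: sibling_trans sv; rewrite sibling_sym.
  have [s [ls s_v nsr]] := sibling_below ur suv nvu (lpi _ sr).
  by exists s; split=> //; apply/existsP; exists i; rewrite lp.
have [u0 su0 u0r0] := below r0 sib0 neq0.
have common r : sibling p r -> r != p -> u0 <= r.
  move=> sr nr; have [u su ur] := below r sr nr.
  have [<- //|neq_u] := eqVneq u u0.
  have [s [ss su' nsr]] := above u0 u r0 su0 su sib0 u0r0 neq_u.
  have s_r := le_trans su' ur.
  have e : s = r.
    by apply: sibling_le_eq s_r; apply: sibling_trans sr; rewrite sibling_sym.
  have := across r u sr su; rewrite -e.
  by rewrite eq_le su' e ur.
exists u0; split=> // r v sr nr sv nv.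
have [s [ss sv' nsr]] := above u0 v r0 su0 sv sib0 u0r0 nv.
split; last by rewrite lt_neqAle common // across.
have [e|nsp] := eqVneq s p.
  by rewrite -e lt_neqAle sv' andbT eq_sym across.
case/eqP: nv; apply/esym; apply: sibling_le_eq.
  by apply: sibling_trans sv; rewrite sibling_sym.
exact: le_trans (common s ss nsp) sv'.
Qed.

Lemma closed_elementary : elementary inc.
Proof.
split; first exact: irr_pip.
pose class p := [set q | sibling p q].
have classP p q : reflect (class p = class q) (sibling p q).
  apply: (iffP idP) => [sib|e].
    apply/setP => r; rewrite !inE; apply/idP/idP; last exact: sibling_trans sib.
    by apply: sibling_trans; rewrite sibling_sym.
  have: q \in class q by rewrite inE sibling_refl.
  by rewrite -e inE.
(* The parts are indexed by all sets of irreducibles; those that are not classes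
   index empty parts. *)
exists #|{set irr_poset M}|, (fun a => [set p | class p == enum_val a]).
have same_class (a : 'I_#|{set irr_poset M}|) p q :
    class p == enum_val a -> class q == enum_val a -> sibling p q.
  by move=> /eqP cp /eqP cq; apply/classP; rewrite cp.
have neq_classes (a b : 'I_#|{set irr_poset M}|) p q : a != b ->
    class p == enum_val a -> class q == enum_val b -> ~~ sibling p q.
  move=> neq /eqP cp /eqP cq; apply: contra neq => /classP e.
  by apply/eqP/enum_val_inj; rewrite -cp -cq.
split.
- split=> [p|a b neq|p q neq].
  + by exists (enum_rank (class p)); rewrite inE enum_rankK.
  + rewrite -setI_eq0 -subset0; apply/subsetP => p; rewrite !inE => /andP[ci cj].
    by have:= neq_classes a b p p neq ci cj; rewrite sibling_refl.
  apply: (iff_trans (min_inconsP neq)); split=> [/classP e|[a []]].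
    by exists (enum_rank (class p)); rewrite !inE enum_rankK -e.
  by rewrite !inE; apply: same_class.
(* Another member of the class of [p] produces a sibling of [q], so the class of
   [q] is not a singleton. *)
- move=> a b q neq big def_j [p pi pq].
  have [r ri nr] := exists_other pi big; have [l lq] := irr_least_at q.
  move: pi ri; rewrite !inE => cp cr; have sib_pr := same_class a p r cp cr.
  have [u [lu _ /eqP[]]] := sibling_below (ltW pq) sib_pr nr lq.
  apply/set1P; rewrite -def_j inE; have: q \in [set q] by rewrite inE.
  rewrite -def_j inE => /eqP <-; apply/eqP/classP/existsP; exists l; exact/andP.
have cross (a b : 'I_#|{set irr_poset M}|) p q : a != b -> p < q ->
    class p == enum_val a -> class q == enum_val b ->
    (2 <= #|[set p | class p == enum_val a]|)%N ->
    exists p0 q0, [/\ class p0 == enum_val a, class q0 == enum_val b &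
      forall r v, class r == enum_val a -> r != p0 -> class v == enum_val b -> v != q0 ->
        p0 < v /\ q0 < r].
  move=> neq pq cp cq big.
  have [|r0] := exists_other _ big (x := p); first by rewrite inE.
  rewrite inE => r0a nr.
  have [|u [squ cross_u]] := sibling_cross pq (neq_classes _ _ _ _ neq cp cq) _ nr.
    exact: same_class cp r0a.
  exists p, u; split=> //; first by rewrite -(classP q u squ).
  move=> r v ra nrp vb nv.
  exact: cross_u (same_class a p r cp ra) nrp (same_class b q v cq vb) nv.
move=> a b neq big_i big_j.
have [/existsP[p /existsP[q /and3P[pi qj comp]]]|none] := boolP [exists p, exists q,
    [&& class p == enum_val a, class q == enum_val b & p >=< q]]; last first.
  left=> p q; rewrite !inE => pi qj; apply: contraNN none => comp.
  by apply/existsP; exists p; apply/existsP; exists q; apply/and3P.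
right; case: (comparable_ltgtP comp) => [pq|qp|e].
- have [p0 [q0 [p0a q0b cr]]] := cross a b p q neq pq pi qj big_i.
  exists p0, q0; split; rewrite ?inE // => r v; rewrite !inE.
  by case/andP=> ? ? /andP[? ?]; apply: cr.
- rewrite eq_sym in neq.
  have [q0 [p0 [q0b p0a cr]]] := cross b a q p neq qp qj pi big_j.
  exists p0, q0; split; rewrite ?inE // => r v; rewrite !inE.
  by case/andP=> ? ? /andP[? ?]; apply/and_comm; apply: cr.
by have:= neq_classes a b p q neq pi qj; rewrite e sibling_refl.
Qed.

End ClosedSet.

(** * Realising an elementary PIP by a closed set *)

Section Encoding.
Variable P : finType.
Implicit Types (x y : P) (A B : {set P}).

Definition at_most_one A := forall x y, x \in A -> y \in A -> x = y.

Lemma at_most_one_cases A : at_most_one A -> A = set0 \/ exists x, A = [set x].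
Proof.
move=> one; have [->|[x xA]] := set_0Vmem A; first by left.
by right; exists x; apply/setP => y; rewrite !inE; apply/idP/eqP => [yA|->] //; exact: one.
Qed.

(** Labels start at [1], as [0] stands for an empty part. The successor in the
    type keeps [k] positive even for an empty [P]. *)
Definition label x : Sk #|P|.+1 := inord (enum_rank x).+1.

Definition code A : Sk #|P|.+1 := if [pick x in A] is Some x then label x else ord0.

Lemma val_label x : val (label x) = (enum_rank x).+1.
Proof. by apply: inordK; rewrite !ltnS ltnW. Qed.

Lemma label_neq0 x : (label x == ord0) = false.
Proof. by apply/negP => /eqP/(congr1 val); rewrite val_label. Qed.

Lemma eq_label x y : (label x == label y) = (x == y).
Proof.
apply/eqP/eqP => [/(congr1 val)|-> //].
by rewrite !val_label => -[] /val_inj/enum_rank_inj.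
Qed.

Lemma code0 : code set0 = ord0.
Proof. by rewrite /code; case: pickP => // x; rewrite inE. Qed.

Lemma code1 x : code [set x] = label x.
Proof.
by rewrite /code; case: pickP => [y /set1P->|/(_ x)] //; rewrite inE eqxx.
Qed.

Lemma code_label A x : at_most_one A -> (code A == label x) = (x \in A).
Proof.
case/at_most_one_cases=> [->|[y ->]]; first by rewrite code0 eq_sym label_neq0 inE.
by rewrite code1 eq_label inE eq_sym.
Qed.

Lemma code_le A B : at_most_one A -> at_most_one B ->
  (code A <= code B)%O = (A \subset B).
Proof.
rewrite Sk_leE => /at_most_one_cases[->|[x ->]].
  by rewrite code0 eqxx sub0set.
by move=> oneB; rewrite code1 label_neq0 sub1set eq_sym code_label.
Qed.

Lemma code_cap A B : at_most_one A -> at_most_one B ->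
  code (A :&: B) = Sk_sqcap (code A) (code B).
Proof.
rewrite Sk_sqcapE => /at_most_one_cases[->|[x ->]].
  by rewrite set0I code0 if_same.
move=> oneB; rewrite code1 eq_sym code_label //.
case: ifP => xB; first by rewrite (setIidPl _) ?code1 // sub1set.
rewrite -code0; congr code; apply/setP => y; rewrite !inE.
by case: eqP => // ->.
Qed.

Lemma code_merge A B : at_most_one A -> at_most_one B ->
  code [set x in A :|: B | A :|: B \subset [set x]] = Sk_sqcup (code A) (code B).
Proof.
have code_one x : code [set y in [set x] | [set x] \subset [set y]] = label x.
  rewrite -code1; congr code; apply/setP => y; rewrite !inE sub1set inE eq_sym.
  exact: andbb.
rewrite Sk_sqcupE => /at_most_one_cases[->|[x ->]] /at_most_one_cases[->|[y ->]].
- by rewrite code0 eqxx setU0 -code0; congr code; apply/setP => z; rewrite !inE.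
- by rewrite code0 eqxx set0U code1 code_one.
- by rewrite code0 code1 label_neq0 eqxx setU0 code_one.
rewrite !code1 !label_neq0 eq_label; have [->|neq] := eqVneq x y.
  by rewrite setUid code_one.
rewrite -code0; congr code; apply/setP => z; rewrite !inE subUset !sub1set !inE.
by apply/negP => /and3P[_ /eqP xz /eqP yz]; case/eqP: neq; rewrite xz yz.
Qed.

End Encoding.

Section ElementaryPIP.
Variables (d : Order.disp_t) (P : finPOrderType d) (inc : rel P).
Variables (m : nat) (B : 'I_m -> {set P}).
Hypotheses (pip : is_pip inc) (ep0 : EP0 inc B) (ep1 : EP1 B) (ep2 : EP2 B).
Implicit Types (x y p q : P) (I J : {set P}) (i j : 'I_m).
Local Open Scope order_scope.

Lemma part_inj x i j : x \in B i -> x \in B j -> i = j.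
Proof.
case: ep0 => _ disj _ xi xj; apply/eqP/contraT => /disj/disjointFr/(_ xi).
by rewrite xj.
Qed.

Lemma same_part_min x y i : x \in B i -> y \in B i -> x != y -> min_incons inc x y.
Proof. by case: ep0 => _ _ part xi yi /part[_]; apply; exists i. Qed.

Lemma same_part_bound x y z i :
  x \in B i -> y \in B i -> x <= z -> y <= z -> x = y.
Proof.
move=> xi yi xz yz; apply/eqP/contraT => /(same_part_min xi yi)[].
by rewrite (inc_no_bound pip xz yz).
Qed.

Lemma consistent_idealP I : reflect
  ((forall p q, p \in I -> q <= p -> q \in I) /\
   (forall p q, p \in I -> q \in I -> ~~ inc p q))
  (I \in consistent_ideals inc).
Proof.
rewrite inE; apply: (iffP andP) => [[/forall_inP ideal /forall_inP cons]|[ideal cons]].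
  split=> p q pI; last by apply/forall_inP: (cons p pI) q.
  by have /forallP/(_ q)/implyP := ideal p pI; apply.
split; apply/forall_inP => p pI.
  by apply/forallP => q; apply/implyP; apply: ideal.
by apply/forall_inP => q; apply: cons.
Qed.

Lemma consistent_part I i : I \in consistent_ideals inc -> at_most_one (I :&: B i).
Proof.
case/consistent_idealP=> _ cons x y /setIP[xI xi] /setIP[yI yi].
apply/eqP/contraT => /(same_part_min xi yi)[].
by rewrite (negPf (cons x y xI yI)).
Qed.

Definition same_part x y := [exists i, (x \in B i) && (y \in B i)].

Definition merge I J :=
  [set x in I :|: J | [forall y in I :|: J, same_part x y ==> (y == x)]].

Lemma merge_sym I J : merge I J = merge J I.
Proof. by rewrite /merge setUC. Qed.

(** The operation [merge] acts part by part, which matches it with the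
    coordinatewise [sqcup]. *)
Lemma merge_part I J i : let U := (I :&: B i) :|: (J :&: B i) in
  merge I J :&: B i = [set x in U | U \subset [set x]].
Proof.
rewrite /= -setIUl; apply/setP => x; rewrite !inE -!andbA; apply: andb_id2l => xU.
rewrite andbC; apply: andb_id2l => xi; apply/forall_inP/subsetP => uniq y.
  case/setIP=> yU yi; rewrite inE; apply: (implyP (uniq y yU)).
  by apply/existsP; exists i; rewrite xi.
move=> yU; apply/implyP => /existsP[j /andP[xj yj]].
have := uniq y; rewrite !inE in yU *; rewrite yU; apply.
by rewrite (part_inj xi xj).
Qed.

(** If [p] were dropped, [J] would contain another member [p2] of the part of
    [p]. By (EP1) the part of [q] then has several elements, and (EP2) gives the
    crossing points [p0] and [q0]. If [p != p0], then [q0 < p < q] with [q0] and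
    [q] in the same part, which is impossible; so [p = p0], hence [q0 < p2] and [q0] is in [J]. Either [q0 != q] and [q] should have been dropped
    as well, or [p < q = q0 < p2] contradicts the inconsistency of [p] and [p2]. *)
Lemma merge_down I J p q :
  I \in consistent_ideals inc -> J \in consistent_ideals inc ->
  q \in merge I J -> q \in I -> p <= q -> p \in merge I J.
Proof.
move=> /consistent_idealP[idI consI] /consistent_idealP[idJ _] qM qI pq.
have pI := idI q p qI pq; rewrite inE in_setU pI /=.
apply/forall_inP => p2 p2U; apply/implyP => /existsP[i /andP[pi p2i]].
apply/contraT => neq_p2; have min_p := same_part_min p2i pi neq_p2.
have p2J : p2 \in J.
  by case/setUP: p2U => // /(consI p2 p)/(_ pI); case: min_p => ->.
have alone y : y \in J -> same_part q y -> y = q.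
  move=> yJ qy; move: qM; rewrite inE => /andP[_ /forall_inP/(_ y)].
  by rewrite inE yJ orbT qy => /(_ isT)/eqP.
have [j qj] : exists j, q \in B j by case: ep0.
have neq_ij : i != j.
  apply: contraNneq neq_p2 => e; rewrite -e in qj.
  rewrite (alone p2 p2J) ?(same_part_bound pi qj pq) //.
  by apply/existsP; exists i; rewrite qj.
have lt_pq : p < q.
  rewrite lt_neqAle pq andbT; apply: contraNneq neq_ij => e.
  by rewrite (part_inj pi (j := j)) ?e.
have big_i : (2 <= #|B i|)%N.
  by apply/card_gt1P; exists p2, p.
have big_j : (2 <= #|B j|)%N.
  rewrite leqNgt ltnS; apply/negP => small_j.
  have defj : B j = [set q].
    apply/eqP; rewrite eq_sym eqEcard sub1set qj cards1 //.
  by case: (ep1 neq_ij big_i defj); exists p.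
case: (ep2 neq_ij big_i big_j) => [incomp|[p0 [q0 [p0i q0j cross]]]].
  by have:= incomp p q pi qj; rewrite (le_comparable pq).
have crossR z : z \in B i -> z != p0 -> q0 < z.
  move=> zi nz; have [y yj ny] := exists_other q0j big_j.
  by case: (cross z y); rewrite // !inE ?nz ?ny.
have def_p : p = p0.
  apply/eqP/contraT => /(crossR p pi) q0p; have q0q := lt_trans q0p lt_pq.
  by move: (q0q); rewrite (same_part_bound q0j qj (ltW q0q) (lexx q)) ltxx.
have q0p2 : q0 < p2 by apply: crossR; rewrite // -def_p.
have def_q : q0 = q.
  apply: alone; first exact: idJ p2J (ltW q0p2).
  by apply/existsP; exists j; rewrite qj.
case/eqP: neq_p2; apply: same_part_bound p2i pi (lexx _) _.
by rewrite ltW // (lt_trans lt_pq) // -def_q.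
Qed.

Lemma merge_in I J : I \in consistent_ideals inc -> J \in consistent_ideals inc ->
  merge I J \in consistent_ideals inc.
Proof.
move=> cI cJ; apply/consistent_idealP.
have down p q : p \in merge I J -> q <= p -> q \in merge I J.
  move=> pM qp; have: p \in I :|: J by move: pM; rewrite inE => /andP[].
  case/setUP=> [pI|pJ]; first exact: merge_down pM pI qp.
  by rewrite merge_sym in pM *; apply: merge_down pM pJ qp.
split=> // p q pM qM; apply/negP => /(min_incons_below pip)[p' [q' [p'p q'q min_pq]]].
have [p'M q'M] := (down p p' pM p'p, down q q' qM q'q).
have neq : p' != q'.
  apply/eqP => e; case: min_pq => + _.
  by rewrite e (inc_no_bound pip (lexx q') (lexx q')).
have [i [p'i q'i]] : exists i, p' \in B i /\ q' \in B i by case: ep0 => _ _ part; apply/part.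
have : [set p'; q'] \subset merge I J :&: B i.
  by rewrite subUset !sub1set !in_setI p'M q'M p'i q'i.
rewrite merge_part subUset !sub1set !inE => /andP[/andP[p'U _] /andP[_ /subsetP/(_ p')]].
by rewrite !inE p'U => /(_ isT); rewrite (negPf neq).
Qed.

Lemma setI_in I J : I \in consistent_ideals inc -> J \in consistent_ideals inc ->
  I :&: J \in consistent_ideals inc.
Proof.
move=> /consistent_idealP[idI consI] /consistent_idealP[idJ _].
apply/consistent_idealP; split=> p q /setIP[pI pJ].
  by move=> qp; rewrite inE (idI p q) // (idJ p q).
by case/setIP=> qI _; apply: consI.
Qed.

Definition encode I : Skn #|P|.+1 m := [tuple code (I :&: B i) | i < m].

Definition decode (v : Skn #|P|.+1 m) : {set P} :=
  [set x | [exists i, (x \in B i) && (tnth v i == label x)]].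

Lemma encodeK I : I \in consistent_ideals inc -> decode (encode I) = I.
Proof.
move=> cI; apply/setP => x; rewrite inE; apply/existsP/idP => [[i /andP[_]]|xI].
  by rewrite tnth_mktuple code_label; [case/setIP | exact: consistent_part].
have [i xi] : exists i, x \in B i by case: ep0.
exists i; rewrite xi tnth_mktuple code_label ?inE ?xI //; exact: consistent_part.
Qed.

Lemma encode_le I J : I \in consistent_ideals inc -> J \in consistent_ideals inc ->
  (encode I <= encode J) = (I \subset J).
Proof.
move=> cI cJ; apply/Skn_leP/subsetP => [le x xI|sub i]; last first.
  rewrite !tnth_mktuple code_le; [|exact: consistent_part..].
  by apply: setSI; apply/subsetP.
have [i xi] : exists i, x \in B i by case: ep0.
move: (le i); rewrite !tnth_mktuple code_le; [|exact: consistent_part..].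
by move/subsetP/(_ x); rewrite !inE xI xi => /(_ isT)/andP[].
Qed.

Lemma encode_closed : sq_closed (encode @: consistent_ideals inc).
Proof.
split=> [|_ _ /imsetP[I cI ->] /imsetP[J cJ ->]].
  apply/set0Pn; exists (encode set0); apply: imset_f; apply/consistent_idealP.
  by split=> p q; rewrite inE.
split.
  suff -> : sqcap (encode I) (encode J) = encode (I :&: J) by apply/imset_f/setI_in.
  apply: eq_from_tnth => i; rewrite !tnth_mktuple setIIl.
  by rewrite [RHS]code_cap //; apply: consistent_part.
suff -> : sqcup (encode I) (encode J) = encode (merge I J) by apply/imset_f/merge_in.
apply: eq_from_tnth => i; rewrite !tnth_mktuple merge_part code_merge //.
all: exact: consistent_part.
Qed.

Lemma encode_isomorphic :
  order_isomorphic (encode @: consistent_ideals inc) (fun v w => v <= w)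
    (consistent_ideals inc) (fun I J => I \subset J).
Proof.
exists decode; split=> [_ _ /imsetP[I cI ->] /imsetP[J cJ ->]||].
- by rewrite !encodeK // => ->.
- by rewrite -imset_comp -[RHS]imset_id; apply: eq_in_imset => I; apply: encodeK.
by move=> _ _ /imsetP[I cI ->] /imsetP[J cJ ->]; rewrite !encodeK // encode_le.
Qed.

End ElementaryPIP.

(** The dimension has to be positive. Only the empty PIP has a decomposition into
    no parts, and a single empty part does just as well for it. *)
Lemma elementary_parts d (P : finPOrderType d) (inc : rel P) : elementary inc ->
  exists m (B : 'I_m -> {set P}), [/\ 0 < m, EP0 inc B, EP1 B & EP2 B].
Proof.
case=> _ [[|m] [B [ep0 ep1 ep2]]]; last by exists m.+1, B.
have no_point (x : P) : False by case: ep0 => /(_ x)[[]].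
exists 1, (fun => set0); split=> //.
- by split=> [x|i j _|x]; [case: (no_point x) | rewrite -setI_eq0 set0I | case: (no_point x)].
by move=> i j y _; rewrite cards0.
Qed.

Theorem theorem7 :
  (forall (k n : nat) (M : {set Skn k n}),
     0 < k -> 0 < n -> sq_closed M -> elementary (@irr_incons _ _ M)) /\
  (forall (d : Order.disp_t) (P : finPOrderType d) (inc : rel P),
     elementary inc ->
     exists (k n : nat) (M : {set Skn k n}),
       [/\ 0 < k, 0 < n, sq_closed M &
           order_isomorphic M (fun x y => (x <= y)%O)
             (consistent_ideals inc) (fun I J => I \subset J)]).
Proof.
split=> [k n M _ _|d P inc elem]; first exact: closed_elementary.
have [pip _] := elem; have [m [B [m_gt0 ep0 ep1 ep2]]] := elementary_parts elem.
exists #|P|.+1, m, (encode B @: consistent_ideals inc); split=> //.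
- exact: encode_closed.
- exact: encode_isomorphic.
Qed.
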